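(* Let $A$ be a nonsingular $3\times3$ real matrix on $S^8(\sqrt3)$ with $\det A>0$. Then the nearest singular neighbor to $A$ on $S^8(\sqrt3)$ lies on the boundary of the cross-sectional $5$-cell of the tubular neighborhood $N$ of $SO(3)$ which contains $A$.
   Context: Real $3\times3$ matrices are identified with points of $\mathbb{R}^9$ with the Euclidean inner product $\langle A,B\rangle=\operatorname{tr}(A^TB)$, and $S^8(\sqrt3)$ is the round sphere of matrices of norm $\sqrt3$ with its geodesic (great circle) distance. $D^5$ is the set of symmetric positive definite matrices on $S^8(\sqrt3)$, an open $5$-cell in the great $5$-sphere of symmetric matrices. The tubular neighborhood $N$ of $SO(3)$ is $N=\bigcup_{U\in SO(3)}UD^5$ (the set of matrices of positive determinant on $S^8(\sqrt3)$); its cross-sectional $5$-cells are the pairwise disjoint sets $UD^5=\{UP:P\in D^5\}$, $U\in SO(3)$. The boundary of $UD^5$ is its boundary within the great $5$-sphere containing it, i.e. $U$ times the set of symmetric positive semi-definite matrices on $S^8(\sqrt3)$ that are not positive definite. A nearest singular neighbor to $A$ is a singular matrix on $S^8(\sqrt3)$ at least distance from $A$ among all singular matrices on $S^8(\sqrt3)$ (it need not be unique; the assertion applies to any such matrix). *)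

(* Defs.v *)
From mathcomp Require Import all_boot all_order all_algebra.
From mathcomp Require Import all_classical all_reals all_analysis.

Set Implicit Arguments.
Unset Strict Implicit.
Unset Printing Implicit Defensive.

Import Order.TTheory GRing.Theory Num.Theory.
Import numFieldNormedType.Exports.

Local Open Scope classical_set_scope.
Local Open Scope ring_scope.

Section Defs.
Variable R : realType.
Implicit Types A B U P : 'M[R]_3.

Definition mxdot A B : R := \tr (A^T *m B).

(* Not the library's `|A|, which on matrices is the max norm. *)
Definition mxnorm2 A : R := Num.sqrt (mxdot A A).

Definition S8 : set 'M[R]_3 := [set A | mxnorm2 A = Num.sqrt 3].

(* Great circle distance on the sphere of radius sqrt 3: the radius times the
   angle between A and B. It is meaningful only for A, B in S8, where
   Cauchy-Schwarz puts the argument of acos in [-1, 1]. *)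
Definition geodist A B : R := Num.sqrt 3 * acos (mxdot A B / 3).

Definition SO3 : set 'M[R]_3 := [set U | U^T *m U = 1%:M /\ \det U = 1].

Definition symmetric_mx : set 'M[R]_3 := [set P | P^T = P].

Definition posdef_mx : set 'M[R]_3 :=
  [set P | forall x : 'cV[R]_3, x != 0 -> 0 < (x^T *m P *m x) 0 0].

Definition D5 : set 'M[R]_3 := symmetric_mx `&` posdef_mx `&` S8.

(* For U in SO3, these are the cross-sectional 5-cells U D^5 of the tubular
   neighborhood N of SO(3); N is their union. *)
Definition cell U : set 'M[R]_3 := [set U *m P | P in D5].

(* For U in SO3, the great 5-sphere containing cell U. *)
Definition great_sphere U : set 'M[R]_3 :=
  [set U *m P | P in symmetric_mx `&` S8].

(* Topological boundary of C relative to the subspace S, for C a subset of S.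
   The closures are those of the ambient space: intersecting them with S gives
   the closures in S. *)
Definition rel_boundary (T : topologicalType) (S C : set T) : set T :=
  S `&` closure C `&` closure (S `\` C).

(* The topology on 'M[R]_3 is the usual one of R^9. *)
Definition cell_boundary U : set 'M[R]_3 :=
  rel_boundary (great_sphere U) (cell U).

Definition singular_S8 : set 'M[R]_3 := [set B | S8 B /\ B \notin unitmx].

Definition nearest_singular_neighbor A B : Prop :=
  singular_S8 B /\
  forall B', singular_S8 B' -> geodist A B <= geodist A B'.

End Defs.

Arguments S8 {R}.
Arguments SO3 {R}.
Arguments symmetric_mx {R}.
Arguments posdef_mx {R}.
Arguments D5 {R}.
Arguments singular_S8 {R}.

(* Main.v *)
Require Import Defs.
From mathcomp Require Import all_boot all_order all_algebra.
From mathcomp Require Import all_classical all_reals all_analysis.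
From mathcomp Require Import ring lra.

(** Write A = U P with U orthogonal and P symmetric positive semidefinite
([polar_decomposition]). As det A > 0, P is positive definite with positive
determinant ([posdef_det_gt0]), so U is a rotation and A lies in the cell of U;
it lies in no other cell because P is the only positive definite square root of
A^T A ([sqr_posdef_inj]).

Minimizing the distance to A on the sphere means maximizing <A, B>. A singular B
kills a unit vector v, so that only the projection A (I - v v^T) contributes to
<A, B>. Hence the best B for a given v is the normalization of A (I - v v^T),
and the best v is one for which |A v| is smallest ([nearest_projection]). Since
|A v| = |P v|, such a v is an eigenvector of P ([min_sqr_eigenvector]). Then P
commutes with the projection I - v v^T, the product P (I - v v^T) is symmetric
positive semidefinite, and B is U times a multiple of it. Finally, U times a
singular symmetric positive semidefinite matrix is a boundary point of the cell
of U ([mem_cell_boundary]). *)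

Set Implicit Arguments.
Unset Strict Implicit.
Unset Printing Implicit Defensive.

Import Order.TTheory GRing.Theory Num.Theory.
Import numFieldNormedType.Exports.

Local Open Scope ring_scope.

(** * Bilinear forms and positive definiteness *)

Definition blf (R : realType) n (P : 'M[R]_n) (x y : 'cV[R]_n) : R :=
  (x^T *m P *m y) 0 0.

(** Symmetry is stated separately: in the polar decomposition below positivity
of the factor comes first and symmetry is deduced from it. *)
Definition psd (R : realType) n (P : 'M[R]_n) := forall x, 0 <= blf P x x.

Definition posdef (R : realType) n (P : 'M[R]_n) :=
  forall x, x != 0 -> 0 < blf P x x.

Lemma blf0 (R : realType) n (P : 'M[R]_n) x : blf P x 0 = 0.
Proof. by rewrite /blf mulmx0 mxE. Qed.

Lemma psd_posdef (R : realType) n (P : 'M[R]_n) : posdef P -> psd P.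
Proof.
by move=> posP x; have [->|/posP/ltW //] := eqVneq x 0; rewrite blf0.
Qed.

Lemma blfDl (R : realType) n (P : 'M[R]_n) x y z :
  blf P (x + y) z = blf P x z + blf P y z.
Proof. by rewrite /blf linearD /= !mulmxDl mxE. Qed.

Lemma blfDr (R : realType) n (P : 'M[R]_n) x y z :
  blf P x (y + z) = blf P x y + blf P x z.
Proof. by rewrite /blf mulmxDr mxE. Qed.

Lemma blfZl (R : realType) n (P : 'M[R]_n) a x y :
  blf P (a *: x) y = a * blf P x y.
Proof. by rewrite /blf linearZ /= -!scalemxAl mxE. Qed.

Lemma blfZr (R : realType) n (P : 'M[R]_n) a x y :
  blf P x (a *: y) = a * blf P x y.
Proof. by rewrite /blf -!scalemxAr mxE. Qed.

Lemma blf_addmx (R : realType) n (P Q : 'M[R]_n) x y :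
  blf (P + Q) x y = blf P x y + blf Q x y.
Proof. by rewrite /blf mulmxDr mulmxDl mxE. Qed.

Lemma blf_scalemx (R : realType) n (P : 'M[R]_n) a x y :
  blf (a *: P) x y = a * blf P x y.
Proof. by rewrite /blf -scalemxAr -scalemxAl mxE. Qed.

Lemma blf_tr (R : realType) n (P : 'M[R]_n) x y : blf P^T x y = blf P y x.
Proof.
rewrite /blf -[in LHS](trmxK y) -!trmx_mul mulmxA.
by rewrite [LHS]mxE.
Qed.

Lemma blf_mulmx (R : realType) n (P : 'M[R]_n) (M N : 'M[R]_n) x y :
  blf (M^T *m P *m N) x y = blf P (M *m x) (N *m y).
Proof. by rewrite /blf trmx_mul !mulmxA. Qed.

Lemma blf_delta (R : realType) n (P : 'M[R]_n) i j :
  blf P (delta_mx i 0) (delta_mx j 0) = P i j.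
Proof. by rewrite /blf trmx_delta -rowE -colE !mxE. Qed.

Lemma blf1E (R : realType) n (x : 'cV[R]_n) :
  blf 1%:M x x = \sum_i x i 0 ^+ 2.
Proof.
by rewrite /blf mulmx1 mxE; apply: eq_bigr => i _; rewrite mxE expr2.
Qed.

Lemma blf1_gt0 (R : realType) n : posdef (1%:M : 'M[R]_n).
Proof.
move=> x x0; rewrite blf1E lt_neqAle sumr_ge0 ?andbT => [|i _]; last first.
  exact: sqr_ge0.
rewrite eq_sym psumr_eq0; last by move=> i _; exact: sqr_ge0.
apply: contra x0 => /allP h; apply/eqP/colP => i; rewrite mxE.
by apply/eqP; rewrite -sqrf_eq0; apply: h; rewrite mem_index_enum.
Qed.

Lemma blf1_ge0 (R : realType) n : psd (1%:M : 'M[R]_n).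
Proof. exact/psd_posdef/blf1_gt0. Qed.

Lemma blf1_eq0 (R : realType) n (x : 'cV[R]_n) : blf 1%:M x x = 0 -> x = 0.
Proof. by move=> h; apply/eqP/contraT => /blf1_gt0; rewrite h ltxx. Qed.

(** The variational principle in its simplest form: a function of t that
vanishes and is minimal at 0 has zero linear term. *)
Lemma linear_term_eq0 (R : realFieldType) (a c : R) :
  (forall t : R, 0 <= t * a + t ^+ 2 * c) -> a = 0.
Proof.
move=> h; apply/eqP; rewrite -sqrf_eq0.
have c0 : 0 <= c by have := h 1; have := h (-1); nra.
have d0 : c + 1 != 0 by rewrite gt_eqF// ltr_wpDl.
have := h (- a / (c + 1)).
have -> : - a / (c + 1) * a + (- a / (c + 1)) ^+ 2 * c = - (a / (c + 1)) ^+ 2.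
  by field.
rewrite oppr_ge0 => h2; have : (a / (c + 1)) ^+ 2 == 0.
  by rewrite eq_le h2 sqr_ge0.
rewrite !sqrf_eq0 => /eqP e; have := mulfVK d0 a; rewrite e mul0r => <-.
exact: eqxx.
Qed.

(** The point x minimizes the form, so the first variation of the form at x
vanishes in every direction; the direction P x gives |P x|^2 = 0. *)
Lemma psd_isotropic_ker (R : realType) n (P : 'M[R]_n) x :
  P^T = P -> psd P -> blf P x x = 0 -> P *m x = 0.
Proof.
move=> symP psdP Pxx; apply: blf1_eq0.
rewrite -[LHS]/(blf _ _ _) /blf mulmx1 trmx_mul symP -/(blf P x (P *m x)).
set y := P *m x.
suff : 2 * blf P x y = 0.
  by move/eqP; rewrite mulf_eq0 pnatr_eq0 /= => /eqP.
apply: (@linear_term_eq0 _ _ (blf P y y)) => t.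
have := psdP (x + t *: y).
rewrite blfDl !blfDr !blfZl !blfZr Pxx -(blf_tr P x) symP.
by congr (_ <= _); ring.
Qed.

Lemma posdef_unit (R : realType) n (P : 'M[R]_n) :
  posdef P -> P \in unitmx.
Proof.
move=> h; rewrite unitmxE unitfE -det_tr; apply/det0P => -[v v0 vP].
have := h v^T; rewrite -trmx0 (inj_eq (@trmx_inj _ _ _)) => /(_ v0).
by rewrite -blf_tr /blf trmxK vP mul0mx mxE ltxx.
Qed.

(** On the segment from P to the identity all matrices are positive definite,
hence nonsingular, so the determinant, a polynomial in the parameter, keeps the
sign that it has at the identity. *)
Lemma posdef_det_gt0 (R : realType) n (P : 'M[R]_n) :
  posdef P -> 0 < \det P.
Proof.
move=> h.
(* The determinant along the segment (1 - t) P + t I, as a polynomial in t. *)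
pose M : 'M[{poly R}]_n := map_mx polyC P + 'X *: map_mx polyC (1%:M - P).
have ME t : (\det M).[t] = \det ((1 - t) *: P + t *: 1%:M).
  rewrite -horner_evalE -det_map_mx; congr (\det _); apply/matrixP => i j.
  by rewrite !mxE /= horner_evalE !hornerE; ring.
rewrite ltNge; apply/negP => detP.
have [||t /andP[t0 t1]] := @poly_ivt R (\det M) 0 1; first exact: ler01.
  by rewrite !ME !subr0 subrr !scale0r !scale1r addr0 add0r det1 detP ler01.
rewrite /root ME => /negPn/negP; apply; rewrite -unitfE -unitmxE.
apply: posdef_unit => x x0; rewrite blf_addmx !blf_scalemx.
have := h x x0; have := blf1_gt0 x0; nra.
Qed.

(** A semidefinite form vanishes only on the kernel of its matrix. *)
Lemma posdef_of_psd_unit (R : realType) n (P : 'M[R]_n) :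
  P^T = P -> psd P -> P \in unitmx -> posdef P.
Proof.
move=> symP psdP uP x x0; rewrite lt_neqAle psdP andbT eq_sym.
apply: contra x0 => /eqP /(psd_isotropic_ker symP psdP) Px.
by rewrite -(mulKmx uP x) Px mulmx0.
Qed.

Lemma mxtrace_blf (R : realType) n (D P : 'M[R]_n) :
  \tr (D^T *m P *m D) = \sum_i blf P (col i D) (col i D).
Proof. by apply: eq_bigr => i _; rewrite -blf_delta blf_mulmx -colE. Qed.

(** With D = P - Q one has P D + D Q = P^2 - Q^2 = 0, so the traces of D P D
and D Q D add up to 0; both are nonnegative, hence D P D has trace 0 and every
column of D vanishes. *)
Lemma sqr_posdef_inj (R : realType) n (P Q : 'M[R]_n) :
  P^T = P -> Q^T = Q ->
  posdef P -> psd Q -> P *m P = Q *m Q -> P = Q.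
Proof.
move=> symP symQ posP psdQ PQ; apply/eqP; rewrite -subr_eq0; set D := P - Q.
have symD : D^T = D by rewrite linearB /= symP symQ.
have DPQ : P *m D + D *m Q = 0.
  by rewrite mulmxBr mulmxBl PQ addrA subrK subrr.
have tr0 : \tr (D^T *m P *m D) + \tr (D^T *m Q *m D) = 0.
  rewrite [\tr (_ *m Q *m _)]mxtrace_mulC symD mulmxA -linearD /= -!mulmxA.
  by rewrite -mulmxDr DPQ mulmx0 mxtrace0.
have psdP := psd_posdef posP.
have trP : \tr (D^T *m P *m D) = 0.
  apply/eqP; rewrite eq_le; apply/andP; split.
    rewrite -tr0 lerDl mxtrace_blf; apply: sumr_ge0 => i _; exact: psdQ.
  by rewrite mxtrace_blf; apply: sumr_ge0 => i _; exact: psdP.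
apply/eqP/matrixP => i j; rewrite [RHS]mxE.
move: trP; rewrite mxtrace_blf => /eqP.
rewrite psumr_eq0; last by move=> k _; exact: psdP.
move=> /allP /(_ j (mem_index_enum j)) /= Pj.
have [colD|/posP] := eqVneq (col j D) 0; last by rewrite (eqP Pj) ltxx.
by have /colP/(_ i) := colD; rewrite !mxE.
Qed.

(** * Polar decomposition *)

Definition householder (R : realType) n (x : 'cV[R]_n) : 'M[R]_n :=
  1%:M - (2 / blf 1%:M x x) *: (x *m x^T).

Lemma mul_tr_col (R : realType) n (x y : 'cV[R]_n) :
  x^T *m y = (blf 1%:M x y)%:M.
Proof. by rewrite /blf mulmx1 [LHS]mx11_scalar. Qed.

Lemma householder_tr (R : realType) n (x : 'cV[R]_n) :
  (householder x)^T = householder x.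
Proof. by rewrite linearB linearZ /= trmx1 trmx_mul trmxK. Qed.

Lemma householder_orthogonal (R : realType) n (x : 'cV[R]_n) : x != 0 ->
  (householder x)^T *m householder x = 1%:M.
Proof.
move=> /blf1_gt0 x0; rewrite householder_tr /householder.
set b := blf 1%:M x x in x0 *; set N := x *m x^T; set k := 2 / b.
have NN : N *m N = b *: N.
  by rewrite /N mulmxA -(mulmxA x) mul_tr_col mul_mx_scalar -scalemxAl.
have kkb : k * k * b = k + k by rewrite /k; field; rewrite gt_eqF.
rewrite mulmxBl mul1mx mulmxBr mulmx1 -scalemxAl -scalemxAr NN !scalerA.
by rewrite kkb scalerDl opprB addrK subrK.
Qed.

Lemma orthogonal_entry_le1 (R : realType) n (U : 'M[R]_n) i j :
  U^T *m U = 1%:M -> `|U i j| <= 1.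
Proof.
move=> UU; have /matrixP/(_ j j) := UU; rewrite !mxE eqxx => e.
rewrite -(@ler_sqr _ `|U i j|) ?nnegrE ?ler01 // expr1n real_normK ?num_real //.
rewrite -[leRHS]e (bigD1 i) //= mxE expr2 lerDl sumr_ge0 // => k _.
by rewrite mxE -expr2 sqr_ge0.
Qed.

(** The orthogonal group is closed and bounded. It is taken as a set of
flattened matrices in order to apply Heine-Borel to row vectors. *)
Lemma compact_orthogonal (R : realType) n :
  compact [set v : 'rV[R]_(n * n) | (vec_mx v)^T *m vec_mx v = 1%:M]%classic.
Proof.
apply: bounded_closed_compact.
  exists 1; split=> [|r r1 v /= vo]; first exact: num_real.
  apply: le_trans (ltW r1).
  rewrite [leLHS]/Num.norm /= mx_normrE.
  apply/bigmax_leP; split=> // -[i j] _ /=.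
  case/mxvec_indexP: j => j k; rewrite (ord1 i).
  by have := orthogonal_entry_le1 j k vo; rewrite mxE.
have -> : [set v : 'rV[R]_(n * n) | (vec_mx v)^T *m vec_mx v = 1%:M]%classic =
  (\bigcap_(ij : 'I_n * 'I_n) ((fun v : 'rV[R]_(n * n) =>
     \sum_k v ord0 (mxvec_index k ij.1) * v ord0 (mxvec_index k ij.2)) @^-1`
     [set x | x = (1%:M : 'M[R]_n) ij.1 ij.2]))%classic.
  have E v i j : ((vec_mx v)^T *m vec_mx v) i j =
      \sum_k v ord0 (mxvec_index k i) * v ord0 (mxvec_index k j) :> R.
    by rewrite mxE; apply: eq_bigr => k _; rewrite !mxE.
  apply/seteqP; split=> v /= h; first by move=> [i j] _ /=; rewrite -E h.
  by apply/matrixP => i j; rewrite E (h (i, j)).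
apply: closed_bigI => -[i j] _ /=.
apply: preimage_closed; last exact: closed_eq.
move=> v _; apply: (@continuous_big _ _ +%R) => [|k _].
  exact: add_continuous.
by move=> w; apply: continuousM; exact: coord_continuous.
Qed.

Lemma orthogonal_trace_max (R : realType) n (A : 'M[R]_n) :
  exists2 U, U^T *m U = 1%:M &
    forall W, W^T *m W = 1%:M -> \tr (W^T *m A) <= \tr (U^T *m A).
Proof.
have [||v /set_mem /= vo vmax] := @EVT_max_rV R (n * n)%N
   (fun v => \tr ((vec_mx v)^T *m A)) _ _ (@compact_orthogonal R n).
- by exists (mxvec 1%:M) => /=; rewrite mxvecK trmx1 mulmx1.
- apply: continuous_subspaceT.
  have -> : (fun v : 'rV[R]_(n * n) => \tr ((vec_mx v)^T *m A)) =
    (fun v => \sum_i \sum_k v ord0 (mxvec_index k i) * A k i).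
    apply/funext => v; apply: eq_bigr => i _; rewrite mxE.
    by apply: eq_bigr => k _; rewrite !mxE.
  apply: (@continuous_big _ _ +%R) => [|i _]; first exact: add_continuous.
  apply: (@continuous_big _ _ +%R) => [|k _]; first exact: add_continuous.
  by move=> w; apply: continuousM;
    [exact: coord_continuous | exact: cst_continuous].
exists (vec_mx v) => // W Wo.
have := vmax (mxvec W); rewrite mxvecK; apply; apply/mem_set.
by rewrite /= mxvecK.
Qed.

Lemma mxtrace_householderl (R : realType) n (P : 'M[R]_n) x :
  \tr (householder x *m P) = \tr P - 2 / blf 1%:M x x * blf P x x.
Proof.
rewrite mulmxBl mul1mx -scalemxAl linearB linearZ /=.
by rewrite -mulmxA mxtrace_mulC [in LHS]/mxtrace big_ord1.
Qed.

Lemma blf_householderl (R : realType) n (P : 'M[R]_n) x y z :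
  blf (householder y *m P) x z =
  blf P x z - 2 / blf 1%:M y y * blf 1%:M x y * blf P y z.
Proof.
rewrite mulmxBl mul1mx -scalemxAl blf_addmx -scaleNr blf_scalemx mulNr -mulrA.
congr (_ - _ * _); rewrite /blf -(mulmxA y) !mulmxA mul_tr_col mul_scalar_mx.
by rewrite -!scalemxAl mxE /blf mulmx1.
Qed.

(** Let U maximize tr (U^T A) over the orthogonal group and put P = U^T A. Then
tr (W P) <= tr P for all orthogonal W. A reflection W along x turns this into
x^T P x >= 0. A product of two reflections is a rotation of the plane of their
vectors; letting the angle tend to 0 in the plane of two basis vectors shows
that P is symmetric. *)
Lemma polar_decomposition (R : realType) n (A : 'M[R]_n) :
  exists U P, [/\ A = U *m P, U^T *m U = 1%:M, P^T = P & psd P].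
Proof.
have [U UU Umax] := orthogonal_trace_max A.
have UU' : U *m U^T = 1%:M by rewrite (mulmx1C UU).
pose P := U^T *m A.
have Pmax W : W^T *m W = 1%:M -> \tr (W *m P) <= \tr P.
  move=> Wo; rewrite mulmxA -[W *m U^T]trmxK trmx_mul trmxK; apply: Umax.
  by rewrite trmx_mul trmxK mulmxA -(mulmxA W) UU mulmx1 (mulmx1C Wo).
have psdP : psd P.
  move=> x; have [->|x0] := eqVneq x 0; first by rewrite blf0.
  have := Pmax _ (householder_orthogonal x0).
  rewrite mxtrace_householderl gerBl pmulr_rge0 //.
  by rewrite divr_gt0 // blf1_gt0.
exists U, P; split=> //; first by rewrite mulmxA UU' mul1mx.
apply/matrixP => i j; rewrite mxE; have [->//|ij] := eqVneq i j.
(* The rotation is the product of the reflections along e_i and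
   e_i - t e_j; maximality, cleared of the denominator 1 + t^2, becomes
   0 <= t (P j i - P i j) + t^2 (P i i + P j j). *)
pose e k : 'cV[R]_n := delta_mx k 0.
have ee k l : blf 1%:M (e k) (e l) = (k == l)%:R by rewrite blf_delta mxE.
apply/eqP; rewrite -subr_eq0; apply/eqP.
apply: (@linear_term_eq0 _ _ (P i i + P j j)) => t.
pose y := e i + (- t) *: e j.
have yy : blf 1%:M y y = 1 + t ^+ 2.
  rewrite /y blfDl !blfDr !blfZl !blfZr !ee !eqxx (eq_sym j).
  by rewrite (negbTE ij) /=; ring.
have y0 : y != 0.
  apply: contraTneq (ltr_wpDr (sqr_ge0 t) (@ltr01 R)) => y0.
  by rewrite -yy y0 blf0 ltxx.
have xx : blf 1%:M (e i) (e i) = 1 by rewrite ee eqxx.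
have x0 : e i != 0.
  apply: contraTneq (@ltr01 R) => x0.
  by rewrite -xx x0 blf0 ltxx.
have := Pmax (householder (e i) *m householder y).
rewrite trmx_mul mulmxA -(mulmxA _ _ (householder (e i))).
rewrite householder_orthogonal //.
rewrite mulmx1 householder_orthogonal // => /(_ erefl).
rewrite -mulmxA !mxtrace_householderl blf_householderl.
have yx : blf 1%:M (e i) y = 1.
  by rewrite /y blfDr blfZr !ee eqxx (negbTE ij) mulr0 addr0.
rewrite yx yy xx divr1 mulr1.
rewrite /y !blfDl !blfDr !blfZl !blfZr !blf_delta => h.
have d0 : 0 < 1 + t ^+ 2 by rewrite ltr_wpDr ?sqr_ge0 ?ltr01.
move: h; rewrite -subr_ge0 -(pmulr_rge0 _ d0).
set z := _ * _.
have -> : z = 2 * (t * (P j i - P i j) + t ^+ 2 * (P i i + P j j)).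
  by rewrite /z; field; rewrite gt_eqF.
by rewrite pmulr_rge0 ?ltr0n.
Qed.

(** * The sphere and its geodesic distance *)

Lemma mxdotC (R : realType) (A B : 'M[R]_3) : mxdot A B = mxdot B A.
Proof. by rewrite /mxdot -mxtrace_tr trmx_mul trmxK. Qed.

Lemma mxdotDl (R : realType) (A B C : 'M[R]_3) :
  mxdot (A + B) C = mxdot A C + mxdot B C.
Proof. by rewrite /mxdot linearD /= mulmxDl linearD. Qed.

Lemma mxdotZl (R : realType) a (A B : 'M[R]_3) :
  mxdot (a *: A) B = a * mxdot A B.
Proof. by rewrite /mxdot linearZ /= -scalemxAl linearZ. Qed.

Lemma mxdotDr (R : realType) (A B C : 'M[R]_3) :
  mxdot A (B + C) = mxdot A B + mxdot A C.
Proof. by rewrite mxdotC mxdotDl !(mxdotC A). Qed.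

Lemma mxdotZr (R : realType) a (A B : 'M[R]_3) :
  mxdot A (a *: B) = a * mxdot A B.
Proof. by rewrite mxdotC mxdotZl mxdotC. Qed.

Lemma mxdot_ge0 (R : realType) (A : 'M[R]_3) : 0 <= mxdot A A.
Proof.
rewrite /mxdot -[A^T]mulmx1 mxtrace_blf; apply: sumr_ge0 => i _.
exact: blf1_ge0.
Qed.

Lemma mxdot_gt0 (R : realType) (A : 'M[R]_3) : A != 0 -> 0 < mxdot A A.
Proof.
move=> A0; rewrite lt_neqAle mxdot_ge0 andbT eq_sym.
apply: contra A0; rewrite /mxdot -[A^T]mulmx1 mxtrace_blf psumr_eq0.
  move=> /allP h; apply/eqP/matrixP => i j; rewrite [RHS]mxE.
  have /eqP/blf1_eq0/colP/(_ i) := h j (mem_index_enum j).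
  by rewrite !mxE.
by move=> i _; exact: blf1_ge0.
Qed.

Lemma mxdot_isometry (R : realType) (U A B : 'M[R]_3) :
  U^T *m U = 1%:M -> mxdot (U *m A) (U *m B) = mxdot A B.
Proof.
by move=> UU; rewrite /mxdot trmx_mul mulmxA -(mulmxA _ U^T) UU mulmx1.
Qed.

Lemma S8E (R : realType) (A : 'M[R]_3) : S8 A <-> mxdot A A = 3.
Proof.
rewrite /S8 /mxnorm2 /=; split=> [/eqP|->//].
by rewrite eqr_sqrt ?mxdot_ge0 ?ler0n // => /eqP.
Qed.

Lemma normalize_S8 (R : realType) (C : 'M[R]_3) : C != 0 ->
  S8 (Num.sqrt (3 / mxdot C C) *: C).
Proof.
move=> /mxdot_gt0 C0; apply/S8E; rewrite mxdotZl mxdotZr mulrA -expr2.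
rewrite sqr_sqrtr ?divr_ge0 ?ler0n ?mxdot_ge0 //.
by rewrite divfK ?gt_eqF.
Qed.

Lemma mxdot_S8_itv (R : realType) (A B : 'M[R]_3) : S8 A -> S8 B ->
  mxdot A B / 3 \in `[-1, 1].
Proof.
move=> /S8E AA /S8E BB; rewrite in_itv /=.
have := mxdot_ge0 (A + B); have := mxdot_ge0 (A + (-1) *: B).
rewrite !mxdotDl !mxdotDr !mxdotZl !mxdotZr AA BB (mxdotC B A) => h1 h2.
by apply/andP; split; lra.
Qed.

Lemma geodist_le (R : realType) (A B B' : 'M[R]_3) : S8 A -> S8 B -> S8 B' ->
  geodist A B <= geodist A B' -> mxdot A B' <= mxdot A B.
Proof.
move=> hA hB hB'; rewrite /geodist ler_pM2l ?sqrtr_gt0 ?ltr0n // => h.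
have i1 := mxdot_S8_itv hA hB; have i2 := mxdot_S8_itv hA hB'.
rewrite -(ler_pM2r (_ : 0 < 3^-1)) ?invr_gt0 ?ltr0n //.
rewrite -(acosK i1) -(acosK i2) leNgt ltr_cos -?leNgt //;
by rewrite in_itv /= acos_ge0 // acos_lepi.
Qed.

(** The equality case of Cauchy-Schwarz: on the sphere, only the normalization
of C attains the maximal inner product with C. *)
Lemma mxdot_max_eq (R : realType) (B C : 'M[R]_3) : S8 B -> C != 0 ->
  mxdot C (Num.sqrt (3 / mxdot C C) *: C) <= mxdot C B ->
  B = Num.sqrt (3 / mxdot C C) *: C.
Proof.
move=> hB C0 h; have hC := normalize_S8 C0.
set c := Num.sqrt _ in h hC *.
apply/eqP; rewrite -subr_eq0; apply: contraT => /mxdot_gt0.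
have c0 : 0 <= c by exact: sqrtr_ge0.
move: hB hC => /S8E hB /S8E hC.
rewrite -scaleN1r !mxdotDl !mxdotDr !mxdotZl !mxdotZr hB (mxdotC B C).
move: hC h; rewrite mxdotZl !mxdotZr => hC h.
have := ler_wpM2l c0 h; nra.
Qed.

(** * Boundary points of the cells *)

Lemma cell_nonsingular (R : realType) (U A : 'M[R]_3) :
  U^T *m U = 1%:M -> cell U A -> A \in unitmx.
Proof.
move=> UU [P [[_ posP] _] <-]; rewrite unitmx_mul (posdef_unit posP) andbT.
by case/mulmx1_unit: UU.
Qed.

Lemma closure_right_limit (R : realType) (V : normedModType R) (C : set V)
    (f : R -> V) :
  {for 0, continuous f} -> (forall t, 0 < t -> C (f t)) -> closure C (f 0).
Proof.
move=> fc fC W /fc; rewrite /= nbhs_filterE => /nbhs_ballP[e /= e0 he].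
exists (f (e / 2)); split; first by apply: fC; rewrite divr_gt0.
apply: he; rewrite /ball /= sub0r normrN ger0_norm ?divr_ge0 ?ltW //.
by rewrite gtr_pMr // invf_lt1 // ltr1n.
Qed.

(** The singular point U Q is itself outside the cell. It is the limit, for t
decreasing to 0, of the normalizations of U (Q + t I), which belong to the cell
because Q + t I is positive definite. *)
Lemma mem_cell_boundary (R : realType) (U Q : 'M[R]_3) :
  U^T *m U = 1%:M -> Q^T = Q -> psd Q -> S8 Q -> U *m Q \notin unitmx ->
  cell_boundary U (U *m Q).
Proof.
move=> UU symQ psdQ hQ sing.
have inS : great_sphere U (U *m Q) by exists Q.
split; first split=> //; last first.
  apply: subset_closure; split=> // /(cell_nonsingular UU).
  by rewrite (negbTE sing).
pose k (t : R) := mxdot (Q + t *: 1%:M) (Q + t *: 1%:M).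
pose f t := Num.sqrt (3 / k t) *: (U *m Q + t *: U).
have kE t : k t = 3 + 2 * \tr Q * t + 3 * t ^+ 2.
  rewrite /k !mxdotDl !mxdotDr !mxdotZl !mxdotZr (proj1 (S8E Q) hQ).
  rewrite (mxdotC 1%:M) /mxdot symQ !mulmx1 trmx1 mxtrace1; ring.
have f0 : f 0 = U *m Q.
  rewrite /f kE mulr0 expr0n mulr0 !addr0 divff ?pnatr_eq0 // sqrtr1 scale1r.
  by rewrite scale0r addr0.
rewrite -f0; apply: closure_right_limit => [|t t0].
  have kc : {for 0, continuous k}.
    rewrite (_ : k = fun t => 3 + 2 * \tr Q * t + 3 * t ^+ 2);
      last exact/funext.
    apply: cvgD; first apply: cvgD.
    - exact: cvg_cst.
    - by apply: cvgMl_tmp; exact: cvg_id.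
    - by apply: cvgMl_tmp; exact: exprn_continuous.
  apply: cvgZ; last first.
    apply: cvgD; first exact: cvg_cst.
    by apply: cvgZr_tmp; exact: cvg_id.
  apply: (@continuous_comp _ _ _ (fun t => 3 / k t) Num.sqrt);
    last exact: sqrt_continuous.
  apply: cvgMl_tmp; apply: cvgV => //.
  by rewrite kE mulr0 expr0n mulr0 !addr0 pnatr_eq0.
have posQt x : x != 0 -> 0 < blf (Q + t *: 1%:M) x x.
  move=> /blf1_gt0 x0; rewrite blf_addmx blf_scalemx.
  by have := psdQ x; have := mulr_gt0 t0 x0; lra.
have Qt0 : Q + t *: 1%:M != 0.
  apply: contraTneq (posdef_unit posQt) => ->.
  by rewrite unitmxE det0 unitr0.
exists (Num.sqrt (3 / k t) *: (Q + t *: 1%:M)); last first.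
  by rewrite -scalemxAr mulmxDr -scalemxAr mulmx1.
split; last exact: normalize_S8.
split.
  by rewrite /symmetric_mx /= linearZ linearD /= linearZ /= trmx1 symQ.
move=> x x0; rewrite -/(blf _ x x) blf_scalemx mulr_gt0 ?posQt //.
by rewrite sqrtr_gt0 divr_gt0 ?ltr0n // mxdot_gt0.
Qed.

(** * The nearest singular matrix *)

(** For a unit vector w this is the orthogonal projection along w. *)
Definition proj_orth (R : realType) n (w : 'cV[R]_n) : 'M[R]_n :=
  1%:M - w *m w^T.

Lemma proj_orth_tr (R : realType) n (w : 'cV[R]_n) :
  (proj_orth w)^T = proj_orth w.
Proof. by rewrite linearB /= trmx1 trmx_mul trmxK. Qed.

Lemma proj_orth_kill (R : realType) n (w : 'cV[R]_n) :
  blf 1%:M w w = 1 -> proj_orth w *m w = 0.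
Proof.
by move=> w1; rewrite mulmxBl mul1mx -mulmxA mul_tr_col w1 mulmx1 subrr.
Qed.

Lemma proj_orth_idem (R : realType) n (w : 'cV[R]_n) :
  blf 1%:M w w = 1 -> proj_orth w *m proj_orth w = proj_orth w.
Proof.
move=> w1; rewrite {2}/proj_orth mulmxBr mulmx1 mulmxA proj_orth_kill //.
by rewrite mul0mx subr0.
Qed.

Lemma mxdot_proj_orth (R : realType) (A : 'M[R]_3) w :
  mxdot A (A *m proj_orth w) = mxdot A A - blf (A^T *m A) w w.
Proof.
rewrite /mxdot mulmxA mulmxBr mulmx1 linearB /=; congr (_ - _).
by rewrite mulmxA mxtrace_mulC [LHS]/mxtrace big_ord1 mulmxA.
Qed.

Lemma mxdot_proj_orth2 (R : realType) (A : 'M[R]_3) w : blf 1%:M w w = 1 ->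
  mxdot (A *m proj_orth w) (A *m proj_orth w) =
  mxdot A A - blf (A^T *m A) w w.
Proof.
move=> w1; rewrite -mxdot_proj_orth /mxdot trmx_mul proj_orth_tr.
rewrite -mulmxA mxtrace_mulC -!mulmxA; congr (\tr (_ *m (_ *m _))).
exact: proj_orth_idem.
Qed.

(** The projection is not zero, since its trace is 3 - 1 = 2. *)
Lemma mulmx_proj_orth_neq0 (R : realType) (A : 'M[R]_3) w :
  A \in unitmx -> blf 1%:M w w = 1 -> A *m proj_orth w != 0.
Proof.
move=> uA w1; apply/eqP => AE.
have : \tr (proj_orth w) = 0.
  by rewrite -(mulKmx uA (proj_orth w)) AE mulmx0 mxtrace0.
rewrite linearB /= mxtrace1 mxtrace_mulC mul_tr_col w1 mxtrace1 => /eqP.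
by rewrite -natrB // pnatr_eq0.
Qed.

Lemma kernel_unit_vector (R : realType) (B : 'M[R]_3) : B \notin unitmx ->
  exists2 v, blf 1%:M v v = 1 & B *m v = 0.
Proof.
rewrite unitmxE unitfE negbK -det_tr => /det0P[u u0 uB].
have v0 : u^T != 0 by rewrite -trmx0 (inj_eq (@trmx_inj _ _ _)).
have Bv : B *m u^T = 0 by rewrite -[B]trmxK -trmx_mul uB trmx0.
have s0 := blf1_gt0 v0; set s := blf _ _ _ in s0.
exists ((Num.sqrt s)^-1 *: u^T); last by rewrite -scalemxAr Bv scaler0.
rewrite blfZl blfZr -/s mulrA -invfM -expr2 sqr_sqrtr ?ltW // mulVf //.
by rewrite gt_eqF.
Qed.

(** Let B kill the unit vector v and let C_w be A composed with the projection
along w. Then <A, B> = <C_v, B>, which is at most the norm of C_v times the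
radius, while the normalization of C_w is a singular competitor with inner
product |C_w| times the radius. Comparing B with the competitor for w = v forces
equality in Cauchy-Schwarz, so B is a multiple of C_v. Comparing it with the
other ones shows that |C_w|^2 = |A|^2 - |A w|^2 is largest, that is |A w|
smallest, at w = v. *)
Lemma nearest_projection (R : realType) (A B : 'M[R]_3) :
  A \in unitmx -> S8 A -> nearest_singular_neighbor A B ->
  exists v, [/\ blf 1%:M v v = 1,
    forall w, blf 1%:M w w = 1 -> blf (A^T *m A) v v <= blf (A^T *m A) w w &
    exists2 c, 0 < c & B = c *: (A *m proj_orth v)].
Proof.
move=> uA hA [[hB sB] Bmin].
have [v v1 Bv] := kernel_unit_vector sB.
pose C w := A *m proj_orth w.
pose c w := Num.sqrt (3 / mxdot (C w) (C w)).
have AC w : blf 1%:M w w = 1 -> mxdot A (C w) = mxdot (C w) (C w).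
  by move=> w1; rewrite mxdot_proj_orth2 // mxdot_proj_orth.
have C_gt0 w : blf 1%:M w w = 1 -> 0 < mxdot (C w) (C w).
  by move=> w1; apply/mxdot_gt0/mulmx_proj_orth_neq0.
have best w : blf 1%:M w w = 1 -> c w * mxdot (C w) (C w) <= mxdot A B.
  move=> w1; rewrite -AC // -mxdotZr.
  have hC : S8 (c w *: C w) by apply/normalize_S8/mulmx_proj_orth_neq0.
  apply: (geodist_le hA hB hC); apply: Bmin; split=> //.
  apply/negP => uC.
  have : c w *: C w *m w = 0.
    by rewrite -scalemxAl -mulmxA proj_orth_kill // mulmx0 scaler0.
  move=> /(congr1 (mulmx (invmx (c w *: C w)))); rewrite mulKmx // mulmx0 => w0.
  by move: w1 => /eqP; rewrite w0 blf0 eq_sym oner_eq0.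
(* B is unchanged by the projection along v, which is self-adjoint. *)
have AB : mxdot A B = mxdot (C v) B.
  rewrite /mxdot trmx_mul proj_orth_tr -mulmxA [RHS]mxtrace_mulC -mulmxA.
  by rewrite mulmxBr mulmx1 mulmxA Bv mul0mx subr0.
have BE : B = c v *: C v.
  apply: mxdot_max_eq => //; first exact: mulmx_proj_orth_neq0.
  by rewrite mxdotZr -AB; exact: best.
have c_gt0 w : blf 1%:M w w = 1 -> 0 < c w.
  by move=> w1; rewrite sqrtr_gt0 divr_gt0 ?ltr0n ?C_gt0.
exists v; split=> //; last by exists (c v) => //; exact: c_gt0.
move=> w w1.
have := best w w1; rewrite AB BE mxdotZr.
have cC u : blf 1%:M u u = 1 ->
  c u * mxdot (C u) (C u) = Num.sqrt (3 * mxdot (C u) (C u)).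
  move=> u1; have k0 := C_gt0 u u1; rewrite /c.
  rewrite -[X in _ * X](ger0_norm (ltW k0)) -sqrtr_sqr -sqrtrM;
    last by rewrite divr_ge0 ?ler0n ?ltW.
  by congr Num.sqrt; field; rewrite gt_eqF.
rewrite !cC // ler_sqrt ?mulr_ge0 ?ler0n ?mxdot_ge0 // ler_pM2l ?ltr0n //.
by rewrite !mxdot_proj_orth2 // lerD2l lerN2.
Qed.

(** With m the minimum, P^2 - m I is positive semidefinite and isotropic at v,
so P^2 v = m v. Factoring, (P + s I) (P v - s v) = 0 with s the square root of
m, and P + s I is injective. *)
Lemma min_sqr_eigenvector (R : realType) n (P : 'M[R]_n) v :
  P^T = P -> psd P -> P \in unitmx -> blf 1%:M v v = 1 ->
  (forall w, blf 1%:M w w = 1 -> blf (P *m P) v v <= blf (P *m P) w w) ->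
  exists s, P *m v = s *: v.
Proof.
move=> symP psdP uP v1 vmin.
set m := blf (P *m P) v v in vmin *.
have blfPP x y : blf (P *m P) x y = blf 1%:M (P *m x) (P *m y).
  by rewrite -blf_mulmx symP mulmx1.
have m0 : 0 <= m.
  rewrite /m blfPP; exact: blf1_ge0.
pose s := Num.sqrt m; exists s.
have ss : s * s = m by rewrite -expr2 sqr_sqrtr.
have Mv : (P *m P - m *: 1%:M) *m v = 0.
  apply: psd_isotropic_ker.
  - by rewrite linearB linearZ /= trmx1 trmx_mul symP.
  - move=> x; have [->|x0] := eqVneq x 0; first by rewrite blf0.
    rewrite blf_addmx -scaleNr blf_scalemx mulNr subr_ge0.
    have a0 := blf1_gt0 x0; set a := blf _ _ _ in a0 *.
    have aV : (Num.sqrt a)^-1 * (Num.sqrt a)^-1 = a^-1.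
      by rewrite -invfM -expr2 sqr_sqrtr // ltW.
    have := vmin ((Num.sqrt a)^-1 *: x).
    rewrite !blfZl !blfZr !mulrA aV mulVf ?gt_eqF // => /(_ erefl).
    by rewrite mulrC ler_pdivlMr.
  - by rewrite blf_addmx -scaleNr blf_scalemx v1 mulr1 subrr.
set u := P *m v - s *: v.
have Pu : P *m u + s *: u = 0.
  move: Mv; rewrite mulmxBl -scalemxAl mul1mx -ss => Mv.
  by rewrite mulmxBr scalerBr scalerA -scalemxAr addrA subrK mulmxA.
have u0 : blf P u u = 0.
  have s1 : 0 <= s * blf 1%:M u u by rewrite mulr_ge0 ?sqrtr_ge0 ?blf1_ge0.
  have : blf P u u + s * blf 1%:M u u = 0.
    rewrite -blf_scalemx -blf_addmx /blf -mulmxA mulmxDl -scalemxAl mul1mx Pu.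
    by rewrite mulmx0 mxE.
  by have := psdP u; lra.
apply/eqP; rewrite -subr_eq0 -/u -(mulKmx uP u).
by rewrite (psd_isotropic_ker symP psdP u0) mulmx0.
Qed.

Theorem mainTheorem9 (R : realType) (A : 'M[R]_3)
    (A_nonsingular : A \in unitmx) (A_S8 : S8 A) (detA_gt0 : 0 < \det A)
    (B : 'M[R]_3) (B_nearest : nearest_singular_neighbor A B) :
  exists U : 'M[R]_3,
    unique (fun V : 'M[R]_3 => SO3 V /\ cell V A) U /\ cell_boundary U B.
Proof.
have [U [P [AE UU symP psdP]]] := polar_decomposition A.
have ATA : A^T *m A = P *m P.
  by rewrite AE trmx_mul symP mulmxA -(mulmxA P) UU mulmx1.
have uP : P \in unitmx by move: A_nonsingular; rewrite AE unitmx_mul => /andP[].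
have posP := posdef_of_psd_unit symP psdP uP.
have detU : \det U = 1.
  have := congr1 determinant UU; rewrite det_mulmx det_tr det1 -expr2.
  move=> /eqP; rewrite sqrf_eq1 => /orP[/eqP //|/eqP dU].
  move: detA_gt0; rewrite AE det_mulmx dU mulN1r oppr_gt0 => dP.
  by have := lt_trans dP (posdef_det_gt0 posP); rewrite ltxx.
exists U; split; first split.
- split=> //; exists P => //; split; first by split.
  apply/S8E; rewrite -(mxdot_isometry _ _ UU) -AE; exact/S8E.
- move=> V [[VV _] [Q [[symQ posQ] _] QE]].
  have PQ : P = Q.
    apply: sqr_posdef_inj => //; first exact: psd_posdef.
    by rewrite -ATA -QE trmx_mul symQ mulmxA -(mulmxA Q) VV mulmx1.
  by rewrite -(mulmxK uP U) -AE -QE -PQ mulmxK.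
have [v [v1 vmin [c c0 BE]]] := nearest_projection A_nonsingular A_S8 B_nearest.
rewrite ATA in vmin.
have [s Pv] := min_sqr_eigenvector symP psdP uP v1 vmin.
have PE : P *m proj_orth v = P - s *: (v *m v^T).
  by rewrite mulmxBr mulmx1 mulmxA Pv -scalemxAl.
have symPE : (P *m proj_orth v)^T = P *m proj_orth v.
  by rewrite PE linearB linearZ /= symP trmx_mul trmxK.
(* As P commutes with the projection E along v, P E = E P E. *)
have psdPE : psd (P *m proj_orth v).
  move=> x; rewrite -[P *m _]symPE trmx_mul proj_orth_tr symP.
  rewrite -(proj_orth_idem v1) -mulmxA -[_ *m P]trmxK trmx_mul symP.
  rewrite proj_orth_tr symPE mulmxA -{1}proj_orth_tr blf_mulmx; exact: psdP.
have BQ : B = U *m (c *: (P *m proj_orth v)).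
  by rewrite BE AE -scalemxAr mulmxA.
have [[hB sB] _] := B_nearest.
rewrite BQ; apply: mem_cell_boundary => //; last by rewrite -BQ.
- by rewrite linearZ /= symPE.
- by move=> x; rewrite blf_scalemx mulr_ge0 // ltW.
- apply/S8E; rewrite -(mxdot_isometry _ _ UU) -BQ; exact/S8E.
Qed.
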